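(* There exists $c_0>0$ such that for every $c\in(0,c_0)$ there exists $\ell_0$ such that for every integer $\ell\ge\ell_0$ there exists $n_0$ such that for every $n\ge n_0$ the following holds: if $G$ is a $3$-graph on $n$ vertices with $\delta(G) \ge (3/4-c)n$, then $G$ contains a tetrahedron packing that covers all but at most $\ell$ vertices.
   Context: A $3$-graph is a set of $3$-element subsets (edges) of a vertex set. $\delta(G)$ is the largest $m$ such that every pair of vertices lies in at least $m$ edges. A tetrahedron is a copy of $K^3_4$, i.e. a $4$-set of vertices all of whose $3$-subsets are edges; a tetrahedron packing is a set of vertex-disjoint tetrahedra. *)

(* Defs.v *)
From mathcomp Require Import all_boot all_order all_algebra.
From mathcomp Require Import reals.
Set Implicit Arguments. Unset Strict Implicit. Unset Printing Implicit Defensive.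

Definition is_3graph (T : finType) (G : {set {set T}}) : bool :=
  [forall e in G, #|e| == 3].

Definition codeg (T : finType) (G : {set {set T}}) (x y : T) : nat :=
  #|[set e in G | (x \in e) && (y \in e)]|.

Definition is_tetrahedron (T : finType) (G : {set {set T}}) (K : {set T}) : bool :=
  (#|K| == 4) && [forall S : {set T}, (S \subset K) && (#|S| == 3) ==> (S \in G)].

Definition is_tet_packing (T : finType) (G : {set {set T}}) (P : {set {set T}}) : bool :=
  [forall K in P, is_tetrahedron G K] && trivIset P.

(* Main.v *)
Require Import Defs.
From mathcomp Require Import all_boot all_order all_algebra.
From mathcomp Require Import reals zify lra.
Import Order.TTheory GRing.Theory Num.Theory.

(* Among all families of disjoint tetrahedra and edges, take one maximising
   5 * #tetrahedra + 2 * #edges; its tetrahedra leave a bounded number of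
   vertices uncovered.
   If the family had few edges and missed six vertices, three disjoint pairs
   of them would on average see more than 8 of the 12 incidences with a tetrahedron of the
   family, so some tetrahedron could be traded for three edges (6 > 5).
   If the family had many edges, each of them extends to a tetrahedron through
   about n/4 vertices.  Two edges cannot use two vertices of the same
   tetrahedron T (2 * 5 > 5 + 2 * 2), so almost every T has a single vertex, its
   hub, extending many of the edges.  Swapping such an edge with T minus its hub
   (the body of T) preserves the weight, hence bodies are as good as free edges.
   A tetrahedron with vertices in four bodies would leave four pairs, which two
   further bodies complete to four edges: 5 + 4 * 2 > 6 * 2.  So the union of
   the bodies, of size about 3n/4, spans no transversal tetrahedron although its
   pairs have relative codegree about 2/3.  Then the non-neighbourhoods of the
   three pairs of an edge nearly partition it, and five vertices chosen along
   these partitions span an edge xzw and a vertex z' with z' outside the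
   neighbourhoods of both xz and xw, too often. *)

Section Tilings.

(** * Neighbourhoods of pairs, and tetrahedra *)

Variables (T : finType) (G : {set {set T}}).
Hypothesis G3 : is_3graph G.

Definition nbr (x y : T) : {set T} := [set z | [set x; y; z] \in G].

Lemma card_edge e : e \in G -> #|e| = 3.
Proof. by move=> eG; apply/eqP; apply: (forall_inP G3). Qed.

Lemma nbr_rot x y z : (z \in nbr x y) = (x \in nbr y z).
Proof. by rewrite !inE -setUA setUC. Qed.

Lemma nbrC x y : nbr x y = nbr y x.
Proof. by apply/setP=> z; rewrite !inE (setUC [set x]). Qed.

Lemma nbr_swap x y z : (z \in nbr x y) = (y \in nbr x z).
Proof. by rewrite nbr_rot nbr_rot nbrC. Qed.

Lemma nbr_neq x y z : z \in nbr x y -> [/\ x != y, x != z & y != z].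
Proof.
rewrite inE => /card_edge; rewrite -setUA cardsU1 cards2 !inE.
by case: eqP => //=; case: eqP => //=; case: eqP.
Qed.

(** Sending [z] to its triple with [x] and [y] is a bijection onto the edges through both, which
    turns the codegree hypothesis into a bound on [nbr]. *)
Lemma card_nbr x y : x != y -> #|nbr x y| = codeg G x y.
Proof.
move=> xy; rewrite /codeg.
have inj : {in nbr x y &, injective (fun z => [set x; y; z])}.
  move=> z z' /nbr_neq[_ xz yz] _ /setP/(_ z); rewrite !inE eqxx orbT.
  by rewrite eq_sym (negPf xz) eq_sym (negPf yz) => /esym/eqP.
rewrite -(card_in_imset inj); apply: eq_card => e; rewrite inE.
apply/imsetP/idP => [[z zN ->]|/andP[eG /andP[xe ye]]].
  by move: zN; rewrite !inE !eqxx !orbT => ->.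
have sub : [set x; y] \subset e by apply/subsetP => u /set2P[]->.
have : #|e :\: [set x; y]| == 1.
  by rewrite cardsD (setIidPr sub) cards2 xy card_edge.
case/cards1P=> z ez; have eE : e = [set x; y; z].
  by rewrite -[LHS](setID e [set x; y]) (setIidPr sub) ez.
by exists z; rewrite // inE -eE.
Qed.

Definition piece (K : {set T}) : bool := (K \in G) || is_tetrahedron G K.

(** A 3-subset of a 4-set omits exactly one vertex [t]; the four choices of [t] correspond to the
    four hypotheses. *)
Lemma tetra4 x y z w :
    z \in nbr x y -> w \in nbr x y -> w \in nbr x z -> w \in nbr y z ->
  is_tetrahedron G [set x; y; z; w].
Proof.
move=> zxy wxy wxz wyz; have [xy xz yz] := nbr_neq _ _ _ zxy.
have [_ xw yw] := nbr_neq _ _ _ wxy; have [_ _ zw] := nbr_neq _ _ _ wxz.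
have cK : #|[set x; y; z; w]| = 4.
  rewrite -!setUA !cardsU1 cards1 !inE.
  by rewrite (negPf xy) (negPf xz) (negPf yz) (negPf xw) (negPf yw) zw.
rewrite /is_tetrahedron cK eqxx; apply/forall_inP=> S /andP[sub /eqP cS].
have : #|[set x; y; z; w] :\: S| == 1 by rewrite cardsD (setIidPr sub) cK cS.
case/cards1P=> t Kt.
have SE : S = [set x; y; z; w] :\ t by rewrite -Kt setDDr setDv set0U (setIidPr sub).
have : t \in [set x; y; z; w] by have := set11 t; rewrite -Kt inE => /andP[].
have eqS (s : {set T}) : S =i s -> s \in G -> S \in G by move=> /setP->.
rewrite !inE => /orP[/orP[/orP[]|]|] /eqP tE; rewrite {}tE {cK cS Kt sub} in SE.
- move: wyz; rewrite inE; apply: eqS => u; rewrite SE !inE.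
  by case: (eqVneq u x) => //= ->; rewrite (negPf xy) (negPf xz) (negPf xw).
- move: wxz; rewrite inE; apply: eqS => u; rewrite SE !inE.
  case: (eqVneq u y) => //= [->|]; last by rewrite orbF.
  by rewrite eq_sym (negPf xy) (negPf yz) (negPf yw).
- move: wxy; rewrite inE; apply: eqS => u; rewrite SE !inE.
  case: (eqVneq u z) => //= [->|]; last by rewrite orbF.
  by rewrite !(eq_sym z) (negPf xz) (negPf yz) (eq_sym w) (negPf zw).
- move: zxy; rewrite inE; apply: eqS => u; rewrite SE !inE.
  case: (eqVneq u w) => //= [->|]; last by rewrite orbF.
  by rewrite !(eq_sym w) (negPf xw) (negPf yw) (negPf zw).
Qed.

(* A tetrahedron weighs 5 and an edge weighs 2. *)
Definition wt (K : {set T}) : nat := 3 * #|K| - 7.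

(** * Tilings of maximum weight and the exchange argument *)

Definition tiling (F : {set {set T}}) : bool :=
  [forall K in F, piece K] && trivIset F.

Definition max_tiling (F : {set {set T}}) : Prop :=
  tiling F /\ forall F', tiling F' -> \sum_(K in F') wt K <= \sum_(K in F) wt K.

Lemma max_tiling_exists : exists F, max_tiling F.
Proof.
have t0 : tiling set0.
  by apply/andP; split; [apply/forall_inP=> K|apply/trivIsetP=> K L]; rewrite inE.
case: (@arg_maxnP _ set0 tiling (fun F => \sum_(K in F) wt K) t0) => F tF mF.
by exists F.
Qed.

Lemma piece_card K : piece K -> (#|K| == 3) || (#|K| == 4).
Proof. by case/orP=> [/card_edge->|/andP[->]] //; rewrite orbT. Qed.

Lemma piece_neq0 K : piece K -> K != set0.
Proof. by move=> /piece_card; rewrite -card_gt0; case/orP=> /eqP->. Qed.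

(** Replacing [A] by [A'] gives another tiling, because every vertex of [A'] was uncovered or is
    freed by [A]. Cancelling the untouched pieces in the maximality inequality leaves the claim. *)
Lemma max_tiling_exchange F (A A' : seq {set T}) :
    max_tiling F -> uniq A -> {subset A <= F} ->
    all piece A' -> pairwise (fun K L : {set T} => [disjoint K & L]) A' ->
    (forall (K : {set T}) x, K \in A' -> x \in K ->
       (x \notin cover F) || has (fun L : {set T} => x \in L) A) ->
  \sum_(K <- A') wt K <= \sum_(K <- A) wt K.
Proof.
move=> [tF maxF] uA sA pA' dA' cA'; move/andP: (tF) => [/forall_inP pF /trivIsetP dFF].
have dF (K L : {set T}) : K \in A' -> L \in F -> L \notin A -> [disjoint K & L].
  move=> KA' LF LA; apply/pred0P=> x /=; apply/negP=> /andP[xK xL].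
  have /orP[/bigcupP[]|/hasP[M MA xM]] := cA' K x KA' xK; first by exists L.
  have ML : M != L by apply: contraNneq LA => <-.
  by have /disjointFr/(_ xM) := dFF _ _ (sA _ MA) LF ML; rewrite xL.
pose F0 := F :\: [set:: A]; pose F' := [set:: A'].
(* Pieces are nonempty, so none is disjoint from itself. Hence [A'] has no repetitions and shares no
   member with [F0], and sums over sequences become sums over sets. *)
have selfdisj K : piece K -> [disjoint K & K] -> False.
  by move=> /piece_neq0/negPf pK; rewrite -setI_eq0 setIid pK.
have uA' : uniq A'.
  elim: (A') pA' dA' => //= K s IH /andP[pK ps] /andP[dK ds]; rewrite IH // andbT.
  by apply/negP=> Ks; apply: (selfdisj K) => //; apply: (allP dK).
have dsj : [disjoint F0 & F'].
  apply/pred0P=> K /=; apply/negP; rewrite !inE => /andP[/andP[KA KF] KA'].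
  by apply: (selfdisj K (pF _ KF)); apply: dF.
have : tiling (F0 :|: F').
  apply/andP; split.
    apply/forall_inP=> K; rewrite !inE => /orP[/andP[_ /pF]//|KA'].
    exact: (allP pA').
  have dd : {in A' &, forall K L : {set T}, K != L -> [disjoint K & L]}.
    elim: (A') dA' => //= K s IH /andP[/allP dK ds] L M.
    rewrite !inE => /predU1P[->|Ls] /predU1P[->|Ms]; rewrite ?eqxx // => LM.
    - exact: dK.
    - by rewrite disjoint_sym; apply: dK.
    - exact: IH.
  apply/trivIsetP=> K L; rewrite !inE => /orP[/andP[KA KF]|KA'] /orP[/andP[LA LF]|LA'] KL.
  - exact: dFF.
  - by rewrite disjoint_sym; apply: dF.
  - exact: dF.
  - exact: dd.
have big_s (s : seq {set T}) : uniq s -> \sum_(K in [set:: s]) wt K = \sum_(K <- s) wt K.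
  by move=> us; rewrite big_uniq //; apply: eq_bigl => K; rewrite inE.
move=> /maxF; rewrite [X in _ <= X](big_setID [set:: A]) /=.
have -> : F :&: [set:: A] = [set:: A].
  by apply/setIidPr/subsetP=> K; rewrite inE => /sA.
have -> : \sum_(K in F0 :|: F') wt K = \sum_(K in F0) wt K + \sum_(K in F') wt K.
  by rewrite -bigU //; apply: eq_bigl => K; rewrite !inE.
by rewrite addnC leq_add2r !big_s.
Qed.

(** * Distinct representatives and counting *)

Lemma exists_notin {U : finType} (A : {set U}) (s : seq U) :
  size s < #|A| -> exists2 x, x \in A & x \notin s.
Proof.
move=> sA; have /subsetPn[x xA xs] : ~~ (A \subset [set:: s]).
  apply: contraL sA => /subset_leq_card le; rewrite -leqNgt (leq_trans le) //.
  by rewrite cardsE card_size.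
by exists x; rewrite // inE in xs.
Qed.

Lemma card_cap_cover (N : {set T}) P :
  trivIset P -> #|N :&: cover P| = \sum_(K in P) #|N :&: K|.
Proof.
move=> tP; rewrite -sum1_card (eq_bigl (fun x => (x \in cover P) && (x \in N))); last first.
  by move=> x; rewrite inE andbC.
rewrite big_trivIset_cond //; apply: eq_bigr => K _.
by rewrite -sum1_card; apply: eq_bigl => x; rewrite inE andbC.
Qed.

Lemma card_setId_sum {U : finType} (A : {set U}) (p : pred U) :
  #|[set x in A | p x]| = \sum_(x in A) p x.
Proof.
rewrite -sum1_card (eq_bigl (fun x => (x \in A) && p x)) => [|x]; last by rewrite inE.
by rewrite big_mkcondr; apply: eq_bigr => x _; case: (p x).
Qed.

Lemma sdr3 (X Y Z : {set T}) : 0 < #|X| -> 1 < #|Y| -> 2 < #|Z| ->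
  exists x y z, [/\ x \in X, y \in Y, z \in Z & uniq [:: x; y; z]].
Proof.
move=> /(exists_notin X [::])[x xX _] /(exists_notin Y [:: x])[y yY yx].
move=> /(exists_notin Z [:: x; y])[z zZ]; rewrite !inE negb_or => /andP[zx zy].
exists x, y, z; split=> //=; rewrite !inE negb_or !(eq_sym x) zx.
by rewrite inE in yx; rewrite yx eq_sym zy.
Qed.

(** With sizes at most 4 and total at least 9, no set is empty and at most one has fewer than three
    elements; the case split lets [sdr3] choose from that one first. *)
Lemma sdr3_of_card (X Y Z : {set T}) :
    #|X| <= 4 -> #|Y| <= 4 -> #|Z| <= 4 -> 8 < #|X| + #|Y| + #|Z| ->
  exists x y z, [/\ x \in X, y \in Y, z \in Z & uniq [:: x; y; z]].
Proof.
move=> X4 Y4 Z4 XYZ; have [X2|X2] := leqP #|X| 2.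
  by apply: sdr3; lia.
have [Y2|Y2] := leqP #|Y| 2.
  have [||| y [x [z [yY xX zZ u]]]] := sdr3 Y X Z; try lia.
  exists x, y, z; split=> //; move: u => /=; rewrite !inE !negb_or.
  by rewrite (eq_sym y x); case/and3P=> /andP[-> ->] ->.
have [||| z [x [y [zZ xX yY u]]]] := sdr3 Z X Y; try lia.
exists x, y, z; split=> //; move: u => /=; rewrite !inE !negb_or !(eq_sym z).
by case/and3P=> /andP[-> ->] ->.
Qed.

Lemma disjoint_set3 (x y z : T) (A : {set T}) :
  [disjoint [set x; y; z] & A] = [&& x \notin A, y \notin A & z \notin A].
Proof. by rewrite disjoints_subset !subUset !sub1set !inE andbA. Qed.

Lemma wt3 e : e \in G -> wt e = 2.
Proof. by move=> /card_edge; rewrite /wt => ->. Qed.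

(** * Few edges leave few uncovered vertices *)

Definition tets (F : {set {set T}}) : {set {set T}} := [set K in F | #|K| == 4].
Definition edges (F : {set {set T}}) : {set {set T}} := [set K in F | #|K| == 3].

Lemma tiling_split F : tiling F -> F = tets F :|: edges F.
Proof.
move=> /andP[/forall_inP pF _]; apply/setP=> K; rewrite !inE -andb_orr.
by case KF: (K \in F) => //=; have := piece_card _ (pF _ KF); rewrite orbC => ->.
Qed.

Lemma trivIset_tets F : tiling F -> trivIset (tets F).
Proof. by case/andP=> _; apply: trivIsetS; apply/subsetP=> K; rewrite inE => /andP[]. Qed.

Lemma card_tets F : tiling F -> 4 * #|tets F| <= #|T|.
Proof.
move=> /trivIset_tets tF; apply: leq_trans (max_card (mem (cover (tets F)))).
move: tF; rewrite /trivIset => /eqP <-.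
rewrite mulnC -sum_nat_const leq_sum // => K.
by rewrite inE => /andP[_ /eqP->].
Qed.

Lemma card_cover_edges F : #|cover (edges F)| <= 3 * #|edges F|.
Proof.
apply: leq_trans (leq_card_cover _) _; rewrite mulnC -sum_nat_const leq_sum // => K.
by rewrite inE => /andP[_ /eqP->].
Qed.

Lemma cover_split F : tiling F -> cover F = cover (tets F) :|: cover (edges F).
Proof.
by move=> tF; rewrite {1}(tiling_split _ tF) /cover bigcup_setU.
Qed.

Lemma uncovered_small F k :
    (forall x y, x != y -> 749 * #|T| <= 1000 * #|nbr x y|) ->
    max_tiling F -> #|edges F| <= k -> 37 * k < #|T| ->
  #|~: cover F| <= 5.
Proof.
move=> deg mF Ek kn; have tF := mF.1; rewrite leqNgt; apply/negP=> R6.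
have [s [us sR ss]] : exists s : seq T,
    [/\ uniq s, {subset s <= ~: cover F} & size s = 6].
  exists (take 6 (enum (~: cover F))); split.
  - by rewrite take_uniq ?enum_uniq.
  - by move=> x /mem_take; rewrite mem_enum.
  - by rewrite size_takel // -cardE.
case: s ss us sR => [|a1 [|b1 [|a2 [|b2 [|a3 [|b3 [|]]]]]]] //= _ us sR.
have {}sR : all (fun x => x \notin cover F) [:: a1; b1; a2; b2; a3; b3].
  by apply/allP=> x /sR; rewrite inE.
(* Otherwise an edge on three uncovered vertices could be added to [F]. *)
have Nsub a b : a \notin cover F -> b \notin cover F -> nbr a b \subset cover F.
  move=> aF bF; apply/subsetP=> v abv; apply/negPn/negP=> vF.
  have := max_tiling_exchange F [::] [:: [set a; b; v]] mF isT.
  have abvG : [set a; b; v] \in G by rewrite inE in abv.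
  rewrite !big_seq1 big_nil wt3 // => /(_ _)/= H; suff : 2 <= 0 by [].
  apply: H => //; first by rewrite /piece abvG.
  by move=> K x; rewrite inE => /eqP->; rewrite !inE => /orP[/orP[]|] /eqP->; rewrite ?aF ?bF ?vF.
have Nle a b : a != b -> a \notin cover F -> b \notin cover F ->
    749 * #|T| <= 1000 * (\sum_(K in tets F) #|nbr a b :&: K| + 3 * k).
  move=> ab aF bF; apply: leq_trans (deg _ _ ab) _; rewrite leq_mul2l /=.
  rewrite -card_cap_cover ?trivIset_tets //.
  rewrite -{1}(setIidPl (Nsub _ _ aF bF)) (cover_split _ tF) setIUr.
  apply: leq_trans (leq_card_setU _ _) _; rewrite leq_add2l.
  apply: leq_trans (subset_leq_card (subsetIr _ _)) _.
  by apply: leq_trans (card_cover_edges _) _; rewrite leq_mul2l Ek.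
move: us sR => /=; rewrite !inE !negb_or -!andbA.
case/and5P=> a1b1 a1a2 a1b2 a1a3 /and5P[a1b3 b1a2 b1b2 b1a3].
case/and5P=> b1b3 a2b2 a2a3 a2b3 /and4P[b2a3 b2b3 a3b3 _].
case/and5P=> a1F b1F a2F b2F /and3P[a3F b3F _].
(* More than 8 incidences would give distinct representatives, hence three disjoint edges of weight
   6 in place of [K], of weight 5. *)
have N8 K : K \in tets F ->
    #|nbr a1 b1 :&: K| + #|nbr a2 b2 :&: K| + #|nbr a3 b3 :&: K| <= 8.
  rewrite inE => /andP[KF /eqP K4]; rewrite leqNgt; apply/negP=> N9.
  have KI (N : {set T}) : #|N :&: K| <= 4 by rewrite -K4 subset_leq_card ?subsetIr.
  have [v1 [v2 [v3 []]]] := sdr3_of_card _ _ _ (KI _) (KI _) (KI _) N9.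
  rewrite !inE => /andP[e1 v1K] /andP[e2 v2K] /andP[e3 v3K].
  rewrite /= !inE negb_or => /and3P[/andP[v12 v13] v23 _].
  have vF x v : v \in K -> x \notin cover F -> x != v.
    by move=> vK; apply: contraNneq => ->; apply/bigcupP; exists K.
  have := max_tiling_exchange F [:: K]
    [:: [set a1; b1; v1]; [set a2; b2; v2]; [set a3; b3; v3]] mF isT.
  rewrite !big_cons !big_nil (wt3 _ e1) (wt3 _ e2) (wt3 _ e3) /wt K4 => H.
  suff : 6 <= 5 by []; apply: H.
  - by move=> L; rewrite inE => /eqP->.
  - by rewrite /= /piece e1 e2 e3.
  - rewrite /= !disjoint_set3 !inE !negb_or.
    rewrite a1a2 a1b2 a1a3 a1b3 b1a2 b1b2 b1a3 b1b3 a2a3 a2b3 b2a3 b2b3 v12 v13 v23.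
    by rewrite !(eq_sym v1) !(eq_sym v2) !vF.
  - move=> L x; rewrite !inE => /or3P[]/eqP->; rewrite !inE => /orP[/orP[]|]/eqP->;
    by rewrite /= ?a1F ?b1F ?a2F ?b2F ?a3F ?b3F ?v1K ?v2K ?v3K ?orbT.
(* With t tetrahedra, summing over the three pairs gives 3 * 749 n <= 1000 (8 t + 9 k). As 4 t <= n,
   this yields 247 n <= 9000 k, contrary to 37 k < n. *)
have := Nle _ _ a1b1 a1F b1F; have := Nle _ _ a2b2 a2F b2F; have := Nle _ _ a3b3 a3F b3F.
have : \sum_(K in tets F) (#|nbr a1 b1 :&: K| + #|nbr a2 b2 :&: K| + #|nbr a3 b3 :&: K|)
    <= \sum_(K in tets F) 8 by apply: leq_sum => K; apply: N8.
rewrite !big_split /= sum_nat_const.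
have := card_tets _ tF; move: #|T| #|tets F| kn => n m.
move: (\sum_(K in _) _) (\sum_(K in _) _) (\sum_(K in _) _) => s1 s2 s3.
clear; lia.
Qed.

(** * Extensions of the edges of a maximal tiling *)

Definition ext (e : {set T}) : {set T} :=
  [set v | (v \notin e) && is_tetrahedron G (v |: e)].

Lemma card_setI3_ge (A B C : {set T}) :
  #|A| + #|B| + #|C| <= #|A :&: B :&: C| + 2 * #|T|.
Proof.
have := cardsUI A B; have := cardsUI (A :&: B) C.
have : #|A :|: B| <= #|T| by apply: max_card.
have : #|A :&: B :|: C| <= #|T| by apply: max_card.
lia.
Qed.

Lemma card3_others (e : {set T}) x : #|e| = 3 -> x \in e ->
  exists y z, [/\ e = [set x; y; z], x != y, x != z & y != z].
Proof.
move=> e3 xe; have [|y ye] := exists_notin e [:: x]; first by rewrite e3.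
rewrite inE => yx; have [|z ze] := exists_notin e [:: x; y]; first by rewrite e3.
rewrite !inE negb_or => /andP[zx zy].
have xyz3 : #|[set x; y; z]| = 3.
  by rewrite -setUA !cardsU1 cards1 !inE negb_or !(eq_sym x) yx zx eq_sym zy.
exists y, z; rewrite eq_sym yx eq_sym zx eq_sym zy; split=> //.
apply/esym/eqP; rewrite eqEcard e3 xyz3 leqnn andbT.
by rewrite !subUset !sub1set xe ye ze.
Qed.

(** A common neighbour of the three pairs of [e] extends it, and three sets of density 0.749 meet in
    density at least 3 * 0.749 - 2 = 0.247. *)
Lemma card_ext e :
    (forall x y, x != y -> 749 * #|T| <= 1000 * #|nbr x y|) -> e \in G ->
  247 * #|T| <= 1000 * #|ext e|.
Proof.
move=> deg eG; have e3 := card_edge _ eG.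
have [x xe] : exists x, x \in e by apply/set0Pn; rewrite -card_gt0 e3.
have [y [z [eE xy xz yz]]] := card3_others e x e3 xe.
have sub : nbr x y :&: nbr x z :&: nbr y z \subset ext e.
  apply/subsetP=> v; rewrite !in_setI => /andP[/andP[vxy vxz] vyz].
  have [_ xv yv] := nbr_neq _ _ _ vxy; have [_ _ zv] := nbr_neq _ _ _ vxz.
  rewrite inE eE !inE !negb_or !(eq_sym v) xv yv zv setUC tetra4 //.
  by rewrite inE -eE.
have := subset_leq_card sub; have := card_setI3_ge (nbr x y) (nbr x z) (nbr y z).
have := deg _ _ xy; have := deg _ _ xz; have := deg _ _ yz.
clear; lia.
Qed.

Lemma wt4 K : is_tetrahedron G K -> wt K = 5.
Proof. by rewrite /wt => /andP[/eqP->]. Qed.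

Lemma in_tets F K : tiling F -> K \in tets F ->
  [/\ K \in F, #|K| = 4 & is_tetrahedron G K].
Proof.
move=> /andP[/forall_inP pF _]; rewrite inE => /andP[KF /eqP K4]; split=> //.
by case/orP: (pF _ KF) => // /card_edge; rewrite K4.
Qed.

Lemma in_edges F e : tiling F -> e \in edges F -> [/\ e \in F, #|e| = 3 & e \in G].
Proof.
move=> /andP[/forall_inP pF _]; rewrite inE => /andP[eF /eqP e3]; split=> //.
by case/orP: (pF _ eF) => // /andP[]; rewrite e3.
Qed.

Lemma tiling_mem_eq F K L x :
  tiling F -> K \in F -> L \in F -> x \in K -> x \in L -> K = L.
Proof.
case/andP=> _ /trivIsetP dF KF LF xK xL; apply/eqP/negPn/negP=> KL.
by have /disjointFr/(_ xK) := dF _ _ KF LF KL; rewrite xL.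
Qed.

Lemma extE e v : v \in ext e -> v \notin e /\ is_tetrahedron G (v |: e).
Proof. by rewrite inE => /andP. Qed.

(** An extending vertex outside the tetrahedra is uncovered or lies in another edge [K]. Growing [e]
    by it would gain 5 at the cost of 2 or of 4. *)
Lemma ext_sub_tets F e : max_tiling F -> e \in edges F -> ext e \subset cover (tets F).
Proof.
move=> mF eE; have tF := mF.1; have [eF e3 eG] := in_edges _ _ tF eE.
apply/subsetP=> v /extE[ve vte]; apply/negPn/negP=> vt.
have [vF|vF] := boolP (v \in cover F).
  move: (vF); rewrite cover_split // inE (negPf vt) /= => /bigcupP[K KE vK].
  have [KF K3 KG] := in_edges _ _ tF KE.
  suff : 5 <= 4 by [].
  have := max_tiling_exchange F [:: e; K] [:: v |: e] mF.
  rewrite !big_cons !big_nil (wt4 _ vte) (wt3 _ eG) (wt3 _ KG); apply => //.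
  - by rewrite /= inE andbT; apply: contraNneq ve => ->.
  - by move=> L; rewrite !inE => /orP[]/eqP->.
  - by rewrite /= /piece vte orbT.
  - by move=> L x; rewrite inE => /eqP-> /setU1P[->|xe] /=; rewrite ?vK ?xe ?orbT.
suff : 5 <= 2 by [].
have := max_tiling_exchange F [:: e] [:: v |: e] mF.
rewrite !big_cons !big_nil (wt4 _ vte) (wt3 _ eG); apply => //.
- by move=> L; rewrite !inE => /eqP->.
- by rewrite /= /piece vte orbT.
- by move=> L x; rewrite inE => /eqP-> /setU1P[->|xe] /=; rewrite ?vF ?xe ?orbT.
Qed.

(** The two extended edges are disjoint tetrahedra of total weight 10, replacing [K], [e] and [e']
    of total weight 9. *)
Lemma no_two_extensions F K e e' v v' :
    max_tiling F -> K \in tets F -> e \in edges F -> e' \in edges F -> e != e' ->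
    v \in K -> v' \in K -> v != v' -> v \in ext e -> v' \in ext e' -> False.
Proof.
move=> mF Kt eE e'E ee' vK v'K vv' /extE[ve vte] /extE[v'e' v'te'].
have tF := mF.1; have [KF K4 Ktet] := in_tets _ _ tF Kt.
have [eF e3 eG] := in_edges _ _ tF eE; have [e'F e'3 e'G] := in_edges _ _ tF e'E.
have notK d x : d \in F -> #|d| = 3 -> x \in K -> x \notin d.
  move=> dF d3 xK; apply/negP=> xd.
  by move: K4; rewrite (tiling_mem_eq _ _ _ _ tF KF dF xK xd) d3.
suff : 10 <= 9 by [].
have := max_tiling_exchange F [:: K; e; e'] [:: v |: e; v' |: e'] mF.
rewrite !big_cons !big_nil (wt4 _ vte) (wt4 _ v'te') (wt4 _ Ktet) (wt3 _ eG) (wt3 _ e'G).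
apply=> //.
- rewrite /= !inE negb_or ee' !andbT.
  by apply/andP; split; apply: contra_eqN K4 => /eqP->; rewrite ?e3 ?e'3.
- by move=> L; rewrite !inE => /or3P[]/eqP->.
- by rewrite /= /piece vte v'te' !orbT.
- rewrite /= !andbT; apply/pred0P=> x /=; apply/negP.
  case/andP=> /setU1P[->|xe] /setU1P[|xe'].
  + by move/eqP; rewrite (negPf vv').
  + by have := notK _ _ e'F e'3 vK; rewrite xe'.
  + by move=> xv'; have := notK _ _ eF e3 v'K; rewrite -xv' xe.
  + by move/eqP: ee'; apply; apply: (tiling_mem_eq _ _ _ _ tF eF e'F xe xe').
- by move=> L x; rewrite !inE => /orP[]/eqP-> /setU1P[->|xe] /=; rewrite ?vK ?v'K ?xe ?orbT.
Qed.

(** * Hubs and bodies *)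

Definition edeg (E : {set {set T}}) (v : T) : nat := #|[set e in E | v \in ext e]|.

(** Extending ten edges is enough for a greedy choice of distinct edges for up to ten hubs at
    once. *)
Definition hub_cond (E : {set {set T}}) (K : {set T}) (v : T) : bool :=
  (v \in K) && (10 <= edeg E v).

Lemma edeg_unique F (E : {set {set T}}) K v v' :
    max_tiling F -> E \subset edges F -> K \in tets F ->
  v \in K -> v' \in K -> v != v' -> 1 < edeg E v -> edeg E v' = 0.
Proof.
move=> mF EF Kt vK v'K vv' d2; apply/eqP; rewrite cards_eq0.
apply/negPn/negP=> /set0Pn[e' /setIdP[e'E v'e']].
have /card_gt1P[e1 [e2 [/setIdP[e1E ve1] /setIdP[e2E ve2] e12]]] := d2.
have [e [eE ve ee']] : exists e, [/\ e \in E, v \in ext e & e != e'].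
  have [e1e'|e1e'] := eqVneq e1 e'; last by exists e1.
  by exists e2; split; rewrite // -e1e' eq_sym.
move/subsetP: EF => EF.
by apply: (no_two_extensions F K e e' v v') => //; apply: EF.
Qed.

(** If a vertex of [K] extends two edges, no other vertex of [K] extends any, so the sum is below 10
    or that vertex is a hub. Otherwise each of the four vertices contributes at most 1. *)
Lemma sum_edeg F (E : {set {set T}}) K : max_tiling F -> E \subset edges F -> K \in tets F ->
  \sum_(v in K) edeg E v <= 10 + #|E| * [exists v, hub_cond E K v].
Proof.
move=> mF EF Kt; have [_ K4 _] := in_tets _ _ mF.1 Kt.
have dE v : edeg E v <= #|E|.
  by apply: subset_leq_card; apply/subsetP=> e; rewrite inE => /andP[].
have [/existsP[v /andP[vK v2]]|noV] := boolP [exists v, (v \in K) && (1 < edeg E v)].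
  rewrite (bigD1 v) //= big1 => [|u /andP[uK uv]]; last first.
    by apply: (edeg_unique F E K v u) => //; rewrite eq_sym.
  rewrite addn0; have [d10|d10] := leqP 10 (edeg E v); last by lia.
  suff -> : [exists v, hub_cond E K v] by rewrite muln1 (leq_trans (dE v)) ?leq_addl.
  by apply/existsP; exists v; rewrite /hub_cond vK.
apply: leq_trans (leq_addr _ _); apply: (@leq_trans (\sum_(v in K) 1)).
  apply: leq_sum => v vK; move: noV; rewrite negb_exists => /forallP/(_ v).
  by rewrite vK /= -leqNgt.
by rewrite sum1_card K4.
Qed.

Definition hubs (E F : {set {set T}}) : {set {set T}} :=
  [set K in tets F | [exists v, hub_cond E K v]].

(** Double counting of pairs of an edge and a vertex extending it, grouped by the tetrahedron
    containing the vertex. *)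
Lemma sum_card_ext F (E : {set {set T}}) : max_tiling F -> E \subset edges F ->
  \sum_(e in E) #|ext e| <= 10 * #|tets F| + #|E| * #|hubs E F|.
Proof.
move=> mF EF; have tF := mF.1.
have -> : \sum_(e in E) #|ext e| = \sum_(K in tets F) \sum_(v in K) edeg E v.
  rewrite -big_trivIset ?trivIset_tets //.
  under eq_bigr => e eE.
    have /setIidPl <- := ext_sub_tets _ _ mF (subsetP EF _ eE).
    rewrite setIC -sum1_card.
    rewrite (eq_bigl (fun v => (v \in cover (tets F)) && (v \in ext e))); last first.
      by move=> v; rewrite inE.
    rewrite big_mkcondr; over.
  rewrite exchange_big; apply: eq_bigr => v _.
  by rewrite -big_mkcondr /edeg -sum1_card; apply: eq_bigl => e; rewrite !inE.
apply: (@leq_trans (\sum_(K in tets F) (10 + #|E| * [exists v, hub_cond E K v]))).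
  by apply: leq_sum => K; apply: sum_edeg.
rewrite big_split /= sum_nat_const mulnC leq_add2l -big_distrr /= leq_mul2l; apply/orP; right.
by rewrite /hubs card_setId_sum.
Qed.

(** [pick] fixes one hub of [K]. The default [set0] arises only without a hub, hence never on
    [hubs E F]. *)
Definition body (E : {set {set T}}) (K : {set T}) : {set T} :=
  if [pick v | hub_cond E K v] is Some v then K :\ v else set0.

Definition bodies (E F : {set {set T}}) : {set {set T}} := body E @: hubs E F.

Lemma hubsP E F K : K \in hubs E F ->
  exists v, [/\ K \in tets F, v \in K, 10 <= edeg E v & body E K = K :\ v].
Proof.
rewrite inE => /andP[Kt /existsP[v hv]]; rewrite /body.
by case: pickP => [u /andP[uK u10]|/(_ v)]; [exists u|rewrite hv].
Qed.

Lemma body_sub E K : body E K \subset K.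
Proof. by rewrite /body; case: pickP => [v _|_]; rewrite ?subD1set ?sub0set. Qed.

Lemma card_body E F K : tiling F -> K \in hubs E F -> #|body E K| = 3.
Proof.
move=> tF /hubsP[v [Kt vK _ ->]]; have [_ K4 _] := in_tets _ _ tF Kt.
by move: K4; rewrite (cardsD1 v) vK => -[].
Qed.

Lemma hubs_in_F E F K : K \in hubs E F -> K \in F.
Proof. by rewrite !inE => /andP[/andP[]]. Qed.

(** Bodies are nonempty and lie in disjoint tetrahedra, so distinct tetrahedra have disjoint,
    distinct bodies; a 3-subset of a tetrahedron is an edge. *)
Lemma bodies_disjoint_edges E F : tiling F ->
  [/\ trivIset (bodies E F), #|bodies E F| = #|hubs E F|
    & forall b, b \in bodies E F -> #|b| = 3 /\ b \in G].
Proof.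
move=> tF; have inj : {in hubs E F &, injective (body E)}.
  move=> K L Kh Lh KL; have : 0 < #|body E K| by rewrite (card_body _ _ _ tF Kh).
  rewrite card_gt0 => /set0Pn[x xb].
  apply: (tiling_mem_eq F _ _ x _ (hubs_in_F _ _ _ Kh) (hubs_in_F _ _ _ Lh)) => //.
    exact: (subsetP (body_sub E K)).
  by apply: (subsetP (body_sub E L)); rewrite -KL.
split; last 1 first.
- move=> b /imsetP[K Kh ->]; have b3 := card_body _ _ _ tF Kh; split=> //.
  have [v [Kt _ _ _]] := hubsP _ _ _ Kh; have [_ _ /andP[_ /forall_inP tK]] := in_tets _ _ tF Kt.
  by apply: tK; rewrite body_sub b3.
- apply/trivIsetP=> _ _ /imsetP[K Kh ->] /imsetP[L Lh ->] KL.
  apply/pred0P=> x /=; apply/negP=> /andP[xK xL]; case/eqP: KL; congr body.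
  apply: (tiling_mem_eq F _ _ x _ (hubs_in_F _ _ _ Kh) (hubs_in_F _ _ _ Lh)) => //.
    exact: (subsetP (body_sub E K)).
  exact: (subsetP (body_sub E L)).
- by rewrite card_in_imset.
Qed.

(** A triple [d] holds a body [d.1.1], its hub [d.1.2] and an edge [d.2] extended by the hub. At
    most nine edges are in use when the next one is chosen among at least ten. *)
Lemma swap_data F (E : {set {set T}}) (bs : seq {set T}) :
    tiling F -> uniq bs -> {subset bs <= bodies E F} -> size bs <= 10 ->
  exists ds : seq ({set T} * T * {set T}),
    [/\ [seq d.1.1 | d <- ds] = bs, uniq [seq d.2 | d <- ds]
      & forall d, d \in ds -> [&& d.1.2 \notin d.1.1, d.1.2 |: d.1.1 \in tets F,
          body E (d.1.2 |: d.1.1) == d.1.1, d.2 \in E & d.1.2 \in ext d.2]].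
Proof.
move=> tF; elim: bs => [|b bs IH]; first by exists [::].
move=> /andP[bbs ubs] sbs sz; have [ds [dsb uds dsP]] : exists ds : seq ({set T} * T * {set T}),
    [/\ [seq d.1.1 | d <- ds] = bs, uniq [seq d.2 | d <- ds]
      & forall d, d \in ds -> [&& d.1.2 \notin d.1.1, d.1.2 |: d.1.1 \in tets F,
          body E (d.1.2 |: d.1.1) == d.1.1, d.2 \in E & d.1.2 \in ext d.2]].
  apply: IH => //; last exact: ltnW.
  by move=> c cbs; apply: sbs; rewrite inE cbs orbT.
have /imsetP[K Kh bE] := sbs b (mem_head _ _).
have [v [Kt vK v10 bK]] := hubsP _ _ _ Kh.
have [|e /setIdP[eE ve] eds] := exists_notin [set e in E | v \in ext e] [seq d.2 | d <- ds].
  by apply: leq_trans v10; rewrite size_map -(size_map (fun d => d.1.1)) dsb.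
exists ((b, v, e) :: ds); split=> /=; rewrite ?dsb ?eds //.
move=> d; rewrite inE => /predU1P[->|/dsP//] /=.
have KE : v |: b = K by rewrite bE bK setD1K.
by rewrite KE Kt -bE eqxx eE ve bE bK setD11.
Qed.

(* Replacing each hub tetrahedron [v |: b] and an edge [e] extended by [v] with
   the tetrahedron [v |: e] frees the body [b] without changing the number of
   tetrahedra, so maximality bounds what fits inside the freed bodies. *)
Lemma swap_bodies F (E : {set {set T}}) (bs A : seq {set T}) :
    max_tiling F -> E \subset edges F ->
    uniq bs -> {subset bs <= bodies E F} -> size bs <= 10 ->
    all piece A -> pairwise (fun K L : {set T} => [disjoint K & L]) A ->
    (forall (K : {set T}) x, K \in A -> x \in K -> has (fun b : {set T} => x \in b) bs) ->
  \sum_(K <- A) wt K <= 2 * size bs.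
Proof.
move=> mF EF ubs sbs sz pA dA cA; have tF := mF.1.
have [ds [dsb uds dsP]] := swap_data F E bs tF ubs sbs sz.
(* [Ts] and [es] are taken out of [F]; [Ns] and [A] are put in. *)
pose Ts := [seq d.1.2 |: d.1.1 | d <- ds]; pose es := [seq d.2 | d <- ds].
pose Ns := [seq d.1.2 |: d.2 | d <- ds].
have dsT d : d \in ds -> [/\ d.1.2 |: d.1.1 \in F, #|d.1.2 |: d.1.1| = 4 &
    is_tetrahedron G (d.1.2 |: d.1.1)].
  by move=> /dsP/and5P[_ /(in_tets _ _ tF)].
have dse d : d \in ds -> [/\ d.2 \in F, #|d.2| = 3 & d.2 \in G].
  by move=> /dsP/and5P[_ _ _ /(subsetP EF)/(in_edges _ _ tF)].
have dsN d : d \in ds -> is_tetrahedron G (d.1.2 |: d.2).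
  by move=> /dsP/and5P[_ _ _ _ /extE[]].
have uTs : uniq Ts.
  apply: (@map_uniq _ _ (body E)); suff -> : map (body E) Ts = bs by [].
  by rewrite -map_comp -[RHS]dsb; apply/eq_in_map => d /dsP/and5P[_ _ /eqP].
have eT d d' x : d \in ds -> d' \in ds -> x \in d.1.2 |: d.1.1 -> x \in d'.2 -> False.
  move=> /dsT[KF K4 _] /dse[eF e3 _] xK xe.
  by move: K4; rewrite (tiling_mem_eq _ _ _ _ tF KF eF xK xe) e3.
have mT d : d \in ds -> d.1.2 |: d.1.1 \in Ts by move=> dd; apply/mapP; exists d.
have me d : d \in ds -> d.2 \in es by move=> dd; apply/mapP; exists d.
have szds : size ds = size bs by rewrite -dsb size_map.
have := max_tiling_exchange F (Ts ++ es) (Ns ++ A) mF.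
rewrite !big_cat /= !big_map.
have -> : \sum_(d <- ds) wt (d.1.2 |: d.2) = 5 * size bs.
  rewrite -szds big_seq (eq_bigr (fun=> 5)) => [|d /dsN/wt4//].
  by rewrite -big_seq big_const_seq count_predT iter_addn_0.
have -> : \sum_(d <- ds) wt (d.1.2 |: d.1.1) = 5 * size bs.
  rewrite -szds big_seq (eq_bigr (fun=> 5)) => [|d /dsT[_ _ /wt4]//].
  by rewrite -big_seq big_const_seq count_predT iter_addn_0.
have -> : \sum_(d <- ds) wt d.2 = 2 * size bs.
  rewrite -szds big_seq (eq_bigr (fun=> 2)) => [|d /dse[_ _ /wt3]//].
  by rewrite -big_seq big_const_seq count_predT iter_addn_0.
rewrite leq_add2l; apply.
- rewrite cat_uniq uTs uds andbT /=; apply/hasPn=> _ /mapP[d dd ->].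
  apply/negP=> /mapP[d' dd' dE]; have [_ d3 _] := dse _ dd.
  by have [_ ] := dsT _ dd'; rewrite -dE d3.
- move=> L; rewrite mem_cat => /orP[]/mapP[d dd ->].
    by have [] := dsT _ dd.
  by have [] := dse _ dd.
- rewrite all_cat pA andbT; apply/allP=> _ /mapP[d /dsN dt ->].
  by rewrite /piece dt orbT.
- rewrite pairwise_cat dA andbT; apply/andP; split.
    (* A vertex shared with [A] lies in some body, so it is in no edge of [es]. Were it the hub of
       [d], the two tetrahedra would coincide and the hub would lie in its own body. *)
    apply/allrelP=> _ K /mapP[d dd ->] KA; apply/pred0P=> x /=; apply/negP.
    case/andP=> xde xK; have /hasP[b bbs xb] := cA K x KA xK.
    move: (bbs); rewrite -dsb => /mapP[d' dd' bE].
    have xd' : x \in d'.1.2 |: d'.1.1 by rewrite -bE inE xb orbT.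
    case/setU1P: xde => [xv|xe]; last exact: (eT d' d x).
    have xd : x \in d.1.2 |: d.1.1 by rewrite xv setU11.
    have [dF _ _] := dsT _ dd; have [d'F _ _] := dsT _ dd'.
    have dd'E := tiling_mem_eq _ _ _ _ tF dF d'F xd xd'.
    have /and5P[vd _ /eqP bd _ _] := dsP _ dd; have /and5P[_ _ /eqP bd' _ _] := dsP _ dd'.
    by case/negP: vd; rewrite -bd dd'E bd' -bE -xv.
  move: uTs uds; rewrite !uniq_pairwise !pairwise_map => uT ue.
  have : pairwise (fun d d' => (d.1.2 |: d.1.1 != d'.1.2 |: d'.1.1) && (d.2 != d'.2)) ds.
    by rewrite pairwise_relI; apply/andP.
  apply: (@sub_in_pairwise _ (mem ds)); last exact/allP.
  move=> d d' dd dd' /= /andP[Kdd' edd'].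
  apply/pred0P=> x /=; apply/negP=> /andP[xd xd'].
  have [dF _ _] := dsT _ dd; have [d'F _ _] := dsT _ dd'.
  have [eF _ _] := dse _ dd; have [e'F _ _] := dse _ dd'.
  case/setU1P: xd => [xv|xe]; case/setU1P: xd' => [xv'|xe'].
  + case/eqP: Kdd'; apply: (tiling_mem_eq F _ _ x) => //; first by rewrite xv setU11.
    by rewrite xv' setU11.
  + by apply: (eT d d' x) => //; rewrite xv setU11.
  + by apply: (eT d' d x) => //; rewrite xv' setU11.
  + by case/eqP: edd'; apply: (tiling_mem_eq F _ _ x).
- move=> K x; rewrite mem_cat => /orP[/mapP[d dd ->]|KA] xK.
    apply/orP; right; apply/hasP; case/setU1P: xK => [->|xe].
      by exists (d.1.2 |: d.1.1); rewrite ?setU11 // mem_cat mT.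
    by exists d.2; rewrite // mem_cat me ?orbT.
  apply/orP; right; have /hasP[b bbs xb] := cA K x KA xK.
  move: bbs; rewrite -dsb => /mapP[d dd bE]; apply/hasP.
  by exists (d.1.2 |: d.1.1); rewrite ?mem_cat ?mT // inE -bE xb orbT.
Qed.

(** * Dense families of bodies *)

Section Bodies.

Variable B : {set {set T}}.
Hypothesis deg : forall x y, x != y -> 749 * #|T| <= 1000 * #|nbr x y|.
Hypothesis trivB : trivIset B.
Hypothesis B3 : forall b, b \in B -> #|b| = 3 /\ b \in G.
Hypothesis bigB : 242 * #|T| <= 1000 * #|B|.
Hypothesis bigT : 200 < #|T|.
(** Bodies count as free edges of weight 2. Six of them suffice below: four met by a transversal
    tetrahedron and two that complete the leftover pairs. *)
Hypothesis packB : forall bs A : seq {set T},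
  uniq bs -> {subset bs <= B} -> size bs <= 6 ->
  all piece A -> pairwise (fun K L : {set T} => [disjoint K & L]) A ->
  (forall (K : {set T}) x, K \in A -> x \in K -> has (fun b : {set T} => x \in b) bs) ->
  \sum_(K <- A) wt K <= 2 * size bs.

Local Notation blk := (pblock B).

Lemma blk_eq b x : b \in B -> x \in b -> blk x = b.
Proof. by move=> bB xb; apply: def_pblock. Qed.

Lemma blk_neq x y : blk x != blk y -> x != y.
Proof. by apply: contraNneq => ->. Qed.

Lemma card_cover_bodies : #|cover B| = 3 * #|B|.
Proof.
move: trivB; rewrite /trivIset => /eqP <-; rewrite mulnC -sum_nat_const.
by apply: eq_bigr => b /B3[].
Qed.

Lemma card_non_nbr x y : x != y -> 1000 * #|~: nbr x y| <= 251 * #|T|.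
Proof. by move=> /deg; have := cardsC (nbr x y); lia. Qed.

Lemma card_nbr_cover x y : x != y ->
  1000 * (3 * #|B|) <= 1000 * #|nbr x y :&: cover B| + 251 * #|T|.
Proof.
move=> /card_non_nbr; rewrite -card_cover_bodies; have := cardsID (nbr x y) (cover B).
have : #|cover B :\: nbr x y| <= #|~: nbr x y|.
  by apply: subset_leq_card; rewrite setDE subsetIr.
rewrite setIC; clear; lia.
Qed.

(** The sets [N] and [N'] meet a body in at most three vertices each. Four incidences in total
    therefore put one vertex in one set and two in the other, which gives distinct [s] and [s']. *)
Lemma find_body (bs : seq {set T}) y z y' z' : size bs <= 5 -> y != z -> y' != z' ->
  exists S s s', [/\ S \in B, S \notin bs & [/\ s \in S, s' \in S, s != s',
    s \in nbr y z & s' \in nbr y' z']].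
Proof.
move=> sz yz yz'; pose N := nbr y z; pose N' := nbr y' z'.
have [/existsP[S /and3P[SB Sbs NS]]|noS] :=
    boolP [exists S, [&& S \in B, S \notin bs & 3 < #|N :&: S| + #|N' :&: S|]].
  have [S3 _] := B3 _ SB.
  have NS3 : #|N :&: S| <= 3 by rewrite -S3 subset_leq_card ?subsetIr.
  have NS3' : #|N' :&: S| <= 3 by rewrite -S3 subset_leq_card ?subsetIr.
  have [N1|N1] := leqP #|N :&: S| 1.
    have /(exists_notin _ [::])[s /setIP[sN sS] _] : 0 < #|N :&: S|.
      by move: NS NS3'; clear; lia.
    have /(exists_notin _ [:: s])[s' /setIP[sN' sS']] : 1 < #|N' :&: S|.
      by move: NS N1; clear; lia.
    by rewrite inE eq_sym => ss'; exists S, s, s'.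
  have /(exists_notin _ [::])[s' /setIP[sN' sS'] _] : 0 < #|N' :&: S|.
    by move: NS NS3; clear; lia.
  have /(exists_notin _ [:: s'])[s /setIP[sN sS]] := N1.
  by rewrite inE => ss'; exists S, s, s'.
have le S : S \in B -> #|N :&: S| + #|N' :&: S| <= 3 + (S \in bs) * 3.
  move=> SB; have [S3 _] := B3 _ SB; have [Sbs|Sbs] := boolP (S \in bs).
    rewrite mul1n (leq_add (n1 := 3)) // -[X in _ <= X]S3 subset_leq_card //;
    by rewrite subsetIr.
  move: noS; rewrite negb_exists => /forallP/(_ S).
  by rewrite SB Sbs /= -leqNgt mul0n addn0.
(* Without such a body the incidences number at most 3 #|B| + 15, yet they number at least 6 #|B| -
   0.502 n, while 3 #|B| >= 0.726 n. *)
have : \sum_(S in B) (#|N :&: S| + #|N' :&: S|) <= \sum_(S in B) (3 + (S \in bs) * 3).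
  exact: leq_sum.
rewrite !big_split /= -!card_cap_cover // sum_nat_const -big_distrl /=.
have : \sum_(S in B) (S \in bs) <= 5.
  apply: leq_trans sz; apply: leq_trans (card_size bs).
  rewrite -sum1_card big_mkcond [X in _ <= X]big_mkcond /=.
  by apply: leq_sum => S _; case: (S \in B) => //; case: (S \in bs).
have := card_nbr_cover _ _ yz; have := card_nbr_cover _ _ yz'; rewrite -/N -/N'.
move=> h1 h2 h3 h4; exfalso; move: h1 h2 h3 h4 bigB bigT.
move: (\sum_(S in B) (S \in bs)) #|N :&: cover B| #|N' :&: cover B| #|B| #|T|.
by move=> k c1 c2 nB nT; clear; lia.
Qed.

Lemma no_transversal_tetrahedron x1 x2 x3 x4 :
    {subset [:: x1; x2; x3; x4] <= cover B} -> uniq (map blk [:: x1; x2; x3; x4]) ->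
  is_tetrahedron G [set x1; x2; x3; x4] -> False.
Proof.
move=> xB ux tx.
have blkB x : x \in [:: x1; x2; x3; x4] -> blk x \in B /\ x \in blk x.
  by move=> /xB xc; rewrite pblock_mem // mem_pblock.
have others x : x \in [:: x1; x2; x3; x4] ->
    exists y z, [/\ blk x = [set x; y; z], x != y, x != z & y != z].
  by move=> /blkB[bB xb]; apply: card3_others => //; have [] := B3 _ bB.
have bT i : blk (nth x1 [:: x1; x2; x3; x4] i) \in B.
  case: (ltnP i 4) => i4; first by have [] := blkB _ (mem_nth x1 (s := [:: x1; x2; x3; x4]) i4).
  by rewrite nth_default //; have [] := blkB _ (mem_head _ _).
have b1 := bT 0; have b2 := bT 1; have b3 := bT 2; have b4 := bT 3.
rewrite /= in b1 b2 b3 b4.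
have [y1 [z1 [E1 xy1 xz1 yz1]]] := others x1 ltac:(by rewrite !inE eqxx ?orbT).
have [y2 [z2 [E2 xy2 xz2 yz2]]] := others x2 ltac:(by rewrite !inE eqxx ?orbT).
have [y3 [z3 [E3 xy3 xz3 yz3]]] := others x3 ltac:(by rewrite !inE eqxx ?orbT).
have [y4 [z4 [E4 xy4 xz4 yz4]]] := others x4 ltac:(by rewrite !inE eqxx ?orbT).
(* [S] completes the pairs left in the bodies of [x1] and [x2]; a different body [R] completes those
   of [x3] and [x4]. *)
have [S [s [s' [SB Sbs [sS sS' ss' sN sN']]]]] :=
  find_body (map blk [:: x1; x2; x3; x4]) _ _ _ _ isT yz1 yz2.
have [R [r [r' [RB Rbs [rR rR' rr' rN rN']]]]] :=
  find_body (S :: map blk [:: x1; x2; x3; x4]) _ _ _ _ isT yz3 yz4.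
have := packB [:: R, S & map blk [:: x1; x2; x3; x4]]
  [:: [set x1; x2; x3; x4]; [set y1; z1; s]; [set y2; z2; s'];
      [set y3; z3; r]; [set y4; z4; r']].
rewrite !inE in sN sN' rN rN'.
rewrite !big_cons big_nil (wt4 _ tx) !wt3 // => H; suff : 13 <= 12 by []; apply: H.
- by rewrite /= in ux Sbs Rbs *; rewrite Rbs Sbs.
- by move=> b; rewrite !inE => /or4P[|||/or3P[]]/eqP->.
- by [].
- by rewrite /= /piece tx sN sN' rN rN' orbT.
(* Disjointness is checked by comparing bodies, except for vertices of one body, whose distinctness
   is already known. *)
{ have y1b : blk y1 = blk x1 by apply: blk_eq => //; rewrite E1 !inE eqxx ?orbT.
  have y2b : blk y2 = blk x2 by apply: blk_eq => //; rewrite E2 !inE eqxx ?orbT.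
  have y3b : blk y3 = blk x3 by apply: blk_eq => //; rewrite E3 !inE eqxx ?orbT.
  have y4b : blk y4 = blk x4 by apply: blk_eq => //; rewrite E4 !inE eqxx ?orbT.
  have z1b : blk z1 = blk x1 by apply: blk_eq => //; rewrite E1 !inE eqxx ?orbT.
  have z2b : blk z2 = blk x2 by apply: blk_eq => //; rewrite E2 !inE eqxx ?orbT.
  have z3b : blk z3 = blk x3 by apply: blk_eq => //; rewrite E3 !inE eqxx ?orbT.
  have z4b : blk z4 = blk x4 by apply: blk_eq => //; rewrite E4 !inE eqxx ?orbT.
  have sb : blk s = S by apply: blk_eq.
  have sb' : blk s' = S by apply: blk_eq.
  have rb : blk r = R by apply: blk_eq.
  have rb' : blk r' = R by apply: blk_eq.
  move: ux Sbs Rbs; rewrite /= !inE !negb_or -!andbA.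
  case/and5P=> n12 n13 n14 n23 /and3P[n24 n34 _] /and4P[S1 S2 S3 S4] /and5P[RS R1 R2 R3 R4].
  rewrite ![[disjoint [set x1; x2; x3; x4] & _]]disjoint_sym !disjoint_set3 !inE !negb_or.
  rewrite ?andbT.
  repeat (apply/andP; split).
  all: rewrite ?(eq_sym _ x1) ?(eq_sym _ x2) ?(eq_sym _ x3) ?(eq_sym _ x4).
  all: rewrite ?ss' ?rr' ?xy1 ?xy2 ?xy3 ?xy4 ?xz1 ?xz2 ?xz3 ?xz4 //.
  all: apply: blk_neq; rewrite ?y1b ?y2b ?y3b ?y4b ?z1b ?z2b ?z3b ?z4b ?sb ?sb' ?rb ?rb' //.
  all: by rewrite eq_sym. }
- move=> K x KA xK.
  have : x \in [set x1; x2; x3; x4] :|: [set y1; z1; s] :|: [set y2; z2; s']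
      :|: [set y3; z3; r] :|: [set y4; z4; r'].
    by move: KA xK; rewrite !inE => /or4P[|||/orP[]]/eqP->; rewrite !inE => ->; rewrite ?orbT.
  rewrite !inE /= E1 E2 E3 E4 !inE.
  by do ![case/orP] => /eqP->; rewrite ?eqxx ?sS ?sS' ?rR ?rR' ?orbT.
Qed.

(** * Transversal edges and doubly missed vertices *)

Definition transversal_edge (x y z : T) : bool :=
  [&& x \in cover B, y \in cover B, z \in cover B,
      uniq (map blk [:: x; y; z]) & z \in nbr x y].

Definition far (x y z : T) : {set T} :=
  [set w in cover B | blk w \notin [:: blk x; blk y; blk z]].

Definition misses (x y z w : T) : nat :=
  (w \notin nbr x y) + (w \notin nbr x z) + (w \notin nbr y z).

Definition doubly_missed (x y z : T) : {set T} := [set w in far x y z | 1 < misses x y z w].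

(** A far vertex missed by no pair would complete a transversal tetrahedron, so the three
    non-neighbourhoods cover the far vertices. *)
Lemma misses_gt0 x y z w : transversal_edge x y z -> w \in far x y z -> 0 < misses x y z w.
Proof.
case/and5P=> xB yB zB u zxy; rewrite inE => /andP[wB wu]; rewrite lt0n.
apply/negP; rewrite /misses !addn_eq0 !eqb0 !negbK => /andP[/andP[wxy wxz] wyz].
apply: (no_transversal_tetrahedron x y z w); last exact: tetra4.
  by move=> v; rewrite !inE => /or4P[]/eqP->.
move: u wu; rewrite /= !inE !negb_or -!andbA => /and4P[-> -> -> _] /and3P[wx wy wz].
by rewrite !(eq_sym _ (blk w)) wx wy wz.
Qed.

Lemma card_far x y z : x \in cover B -> y \in cover B -> z \in cover B ->
  3 * #|B| <= #|far x y z| + 9.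
Proof.
have blk3 v : v \in cover B -> #|blk v| = 3 by move=> /pblock_mem/B3[].
move=> /blk3 x3 /blk3 y3 /blk3 z3; rewrite -card_cover_bodies.
have sub : cover B \subset far x y z :|: (blk x :|: blk y :|: blk z).
  apply/subsetP=> w wB; rewrite in_setU inE wB /= !inE.
  have : w \in blk w by rewrite mem_pblock.
  by do 3![case: eqP => [<- ->|_ /=]; rewrite ?orbT //].
have := subset_leq_card sub.
have := leq_of_leqif (leq_card_setU (far x y z) (blk x :|: blk y :|: blk z)).
have := leq_of_leqif (leq_card_setU (blk x :|: blk y) (blk z)).
have := leq_of_leqif (leq_card_setU (blk x) (blk y)).
by rewrite x3 y3 z3; clear; lia.
Qed.

(** There are at most 3 * 0.251 n misses, and each of the at least 0.726 n - 9 far vertices uses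
    one, leaving at most 0.027 n + 9 for second misses. *)
Lemma card_doubly_missed x y z : transversal_edge x y z ->
  1000 * #|doubly_missed x y z| <= 27 * #|T| + 1000 * 9.
Proof.
move=> t; have /and5P[xB yB zB _ zxy] := t; have [xy xz yz] := nbr_neq _ _ _ zxy.
have le : \sum_(w in far x y z) (1 + (1 < misses x y z w)) <=
    \sum_(w in far x y z) ((w \notin nbr x y) + (w \notin nbr x z) + (w \notin nbr y z)).
  apply: leq_sum => w wf; have := misses_gt0 _ _ _ _ t wf.
  by rewrite -/(misses x y z w); case: (misses x y z w) => [|[|m]].
have sumN (N : {set T}) : \sum_(w in far x y z) (w \notin N) <= #|~: N|.
  rewrite -sum1_card big_mkcond [X in _ <= X]big_mkcond /=; apply: leq_sum => w _.
  by rewrite [w \in ~: N]inE; case: (w \in far x y z); case: (w \in N).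
move: le; rewrite !big_split /= sum1_card.
rewrite -card_setId_sum.
have := sumN (nbr x y); have := sumN (nbr x z); have := sumN (nbr y z).
have := card_non_nbr _ _ xy; have := card_non_nbr _ _ xz; have := card_non_nbr _ _ yz.
have := card_far _ _ _ xB yB zB; move: bigB.
move: (\sum_(w in _) _) (\sum_(w in _) _) (\sum_(w in _) _) => s1 s2 s3.
move: #|~: nbr y z| #|~: nbr x z| #|~: nbr x y| #|far x y z| #|doubly_missed x y z| #|B| #|T|.
clear; lia.
Qed.

Lemma exists_transversal_edge : exists x y z, transversal_edge x y z.
Proof.
have blk3 v : v \in cover B -> #|blk v| = 3 by move=> /pblock_mem/B3[].
have c9 : 9 < #|cover B| by rewrite card_cover_bodies; move: bigB bigT; clear; lia.
have [|x xB _] := exists_notin (cover B) [::]; first exact: leq_trans c9.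
have [|y yB] := exists_notin (cover B) (enum (blk x)).
  by rewrite -cardE blk3 // (leq_trans _ c9).
rewrite mem_enum => ybx.
have xy : blk x != blk y.
  by apply: contraNneq ybx => ->; rewrite mem_pblock.
have [|z /setIP[zN zB]] :=
    exists_notin (nbr x y :&: cover B) (enum (blk x) ++ enum (blk y)).
  rewrite size_cat -!cardE !blk3 //; move: bigB bigT.
  by have := card_nbr_cover _ _ (blk_neq _ _ xy); clear; lia.
rewrite mem_cat !mem_enum negb_or => /andP[zx zy].
exists x, y, z; rewrite /transversal_edge xB yB zB zN andbT /= !inE negb_or xy andbT /=.
by apply/andP; split; apply: contraTneq (zB) => bz; rewrite -mem_pblock -bz.
Qed.

Lemma bodies_too_dense : False.
Proof.
have [x [y [z t]]] := exists_transversal_edge; have /and5P[xB yB zB u zxy] := t.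
have [xy xz yz] := nbr_neq _ _ _ zxy.
(* Since some pair must miss each far vertex, members of [Z] are missed only by [x], [z] and members
   of [W] only by [y], [z]. Both sets have at least 0.224 n - 9 elements. *)
pose Z := [set w in far x y z | (w \in nbr x y) && (w \in nbr y z)].
pose W := [set w in far x y z | (w \in nbr x y) && (w \in nbr x z)].
have only (N N' : {set T}) (S := [set w in far x y z | (w \in N) && (w \in N')]) :
    1000 * #|~: N| <= 251 * #|T| -> 1000 * #|~: N'| <= 251 * #|T| ->
  224 * #|T| <= 1000 * #|S| + 1000 * 9.
  move=> cN cN'; have := card_far _ _ _ xB yB zB.
  have sub : far x y z \subset S :|: (~: N :|: ~: N').
    apply/subsetP=> w wf; have -> : w \in S :|: (~: N :|: ~: N') =
      (w \in N) && (w \in N') || ((w \notin N) || (w \notin N')).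
      by rewrite in_setU /S inE wf !inE.
    by case: (w \in N); case: (w \in N').
  have := subset_leq_card sub; have := leq_of_leqif (leq_card_setU S (~: N :|: ~: N')).
  have := leq_of_leqif (leq_card_setU (~: N) (~: N')); move: cN cN' bigB.
  move: #|S|; clear; lia.
have cZ : 224 * #|T| <= 1000 * #|Z| + 1000 * 9 by apply: only; apply: card_non_nbr.
have cW : 224 * #|T| <= 1000 * #|W| + 1000 * 9 by apply: only; apply: card_non_nbr.
pose bad z' w := (blk w == blk z') || (w \in doubly_missed y z z').
have key z' w : z' \in Z -> w \in W -> ~~ bad z' w ->
    transversal_edge x z w /\ z' \in doubly_missed x z w.
  move=> /setIdP[z'f /andP[z'xy z'yz]] /setIdP[wf /andP[wxy wxz]].
  rewrite negb_or => /andP[wz' wD].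
  have z'xz : z' \notin nbr x z.
    have := misses_gt0 _ _ _ _ t z'f; rewrite /misses z'xy z'yz.
    by case: (z' \in nbr x z).
  have wyz : w \notin nbr y z.
    have := misses_gt0 _ _ _ _ t wf; rewrite /misses wxy wxz.
    by case: (w \in nbr y z).
  move: (z'f) (wf); rewrite !inE !negb_or.
  case/and4P=> z'B z'x z'y z'z /and4P[wB wx wy wz].
  move: (u); rewrite /= !inE !negb_or -!andbA => /and4P[nxy nxz nyz _].
  have tyzz' : transversal_edge y z z'.
    rewrite /transversal_edge yB zB z'B z'yz /= !inE !negb_or nyz.
    by rewrite !(eq_sym _ (blk z')) z'y z'z.
  have txyz' : transversal_edge x y z'.
    rewrite /transversal_edge xB yB z'B z'xy /= !inE !negb_or nxy.
    by rewrite !(eq_sym _ (blk z')) z'x z'y.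
  have txzw : transversal_edge x z w.
    rewrite /transversal_edge xB zB wB wxz /= !inE !negb_or nxz.
    by rewrite !(eq_sym _ (blk w)) wx wz.
  have w1 : w \in far y z z' by rewrite !inE !negb_or wB wy wz wz'.
  have w2 : w \in far x y z' by rewrite !inE !negb_or wB wx wy wz'.
  (* The pair [y], [z] already misses [w], and [w] is not doubly missed by [y], [z], [z']. *)
  have wyz' : w \in nbr y z'.
    move: wD; rewrite inE w1 /= -leqNgt /misses wyz.
    by case: (w \in nbr y z') => //; case: (w \in nbr z z').
  (* In the transversal edge [x], [y], [z'], only the pair [x], [z'] is left to miss [w]. *)
  have wxz' : w \notin nbr x z'.
    have := misses_gt0 _ _ _ _ txyz' w2; rewrite /misses wxy wyz'.
    by case: (w \in nbr x z').
  split; first exact: txzw.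
  (* By symmetry [x], [w] misses [z'], and so does [x], [z]: these are two misses. *)
  rewrite z'B z'x z'z (eq_sym (blk z')) wz' /misses z'xz (nbr_swap x w z') wxz'.
  by case: (z' \in nbr z w).
(* Each pair from [Z] and [W] is bad, counted by [z'], or makes [z'] doubly missed, counted by
   [w]. *)
have cnt : #|Z| * #|W| <= \sum_(z' in Z) #|[set w in W | bad z' w]|
    + \sum_(w in W | transversal_edge x z w) #|doubly_missed x z w|.
  have -> : #|Z| * #|W| = \sum_(z' in Z) \sum_(w in W) 1.
    by rewrite sum_nat_const sum1_card.
  have -> : \sum_(w in W | transversal_edge x z w) #|doubly_missed x z w| =
      \sum_(w in W | transversal_edge x z w) \sum_z' (z' \in doubly_missed x z w).
    by apply: eq_bigr => w _; rewrite -sum1_card big_mkcond; apply: eq_bigr => z' _; case: ifP.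
  rewrite [X in _ + X]exchange_big /=.
  apply: (@leq_trans (\sum_(z' in Z) (#|[set w in W | bad z' w]|
      + \sum_(w in W | transversal_edge x z w) (z' \in doubly_missed x z w)))).
    apply: leq_sum => z' z'Z; rewrite card_setId_sum.
    rewrite [X in _ + X]big_mkcondr -big_split /=; apply: leq_sum => w wW.
    have := key z' w z'Z wW; case: (bad z' w) => // /(_ isT)[-> ->] //.
  rewrite big_split /= leq_add2l [X in X <= _]big_mkcond /=.
  by apply: leq_sum => z' _; case: ifP.
(* The 12 is 3 for the body of [z'] plus the additive 9 of [card_doubly_missed]. *)
have leZ : 1000 * \sum_(z' in Z) #|[set w in W | bad z' w]| <= #|Z| * (27 * #|T| + 1000 * 12).
  rewrite big_distrr -sum_nat_const; apply: leq_sum => z' z'Z.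
  have /setIdP[z'f /andP[z'xy z'yz]] := z'Z.
  move: z'f; rewrite !inE !negb_or => /and4P[z'B z'x z'y z'z].
  move: (u); rewrite /= !inE !negb_or -!andbA => /and4P[nxy nxz nyz _].
  have tyzz' : transversal_edge y z z'.
    rewrite /transversal_edge yB zB z'B z'yz /= !inE !negb_or nyz.
    by rewrite !(eq_sym _ (blk z')) z'y z'z.
  have sub : [set w in W | bad z' w] \subset blk z' :|: doubly_missed y z z'.
    apply/subsetP=> w /setIdP[/setIdP[wf _] /orP[/eqP bw|wd]]; rewrite in_setU ?wd ?orbT //.
    by rewrite -bw mem_pblock; move: wf; rewrite inE => /andP[->].
  apply: (@leq_trans (1000 * (3 + #|doubly_missed y z z'|))).
    have [<- _] := B3 _ (pblock_mem z'B); rewrite leq_mul2l /=.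
    exact: leq_trans (subset_leq_card sub) (leq_card_setU _ _).
  have := card_doubly_missed _ _ _ tyzz'; move: #|doubly_missed y z z'| #|T|; clear; lia.
have leW : 1000 * \sum_(w in W | transversal_edge x z w) #|doubly_missed x z w| <=
    #|W| * (27 * #|T| + 1000 * 9).
  rewrite big_distrr -sum_nat_const big_mkcondr; apply: leq_sum => w _.
  by case: ifP => // /card_doubly_missed.
move: cnt leZ leW cZ cW bigT.
move: #|Z| #|W| #|T| (\sum_(z' in Z) _) (\sum_(w in W | _) _); clear.
move=> a b n s1 s2 ab s1a s2b an bn n200.
(* As n > 200, both sizes exceed 2 (0.027 n + 12), so each of the two sums is less than half of the
   product [a * b]. *)
have A : 54 * n + 1000 * 24 < 1000 * b by lia.
have A' : 54 * n + 1000 * 24 < 1000 * a by lia.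
have : a * (54 * n + 1000 * 24) < a * (1000 * b) by rewrite ltn_mul2l A; lia.
have : b * (54 * n + 1000 * 24) < b * (1000 * a) by rewrite ltn_mul2l A'; lia.
nia.
Qed.

End Bodies.

(** * From few edges to the packing *)

Lemma few_edges F :
    (forall x y, x != y -> 749 * #|T| <= 1000 * #|nbr x y|) ->
    max_tiling F -> 200 < #|T| ->
  #|edges F| < 500.
Proof.
move=> deg mF bigT; have tF := mF.1; rewrite ltnNge; apply/negP=> E500.
have [E EF cE] : exists2 E : {set {set T}}, E \subset edges F & #|E| = 500.
  exists [set:: take 500 (enum (edges F))].
    by apply/subsetP=> e; rewrite inE => /mem_take; rewrite mem_enum.
  rewrite cardsE (card_uniqP _) ?take_uniq ?enum_uniq //.
  by rewrite size_takel // -cardE.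
have [trivB cB B3] := bodies_disjoint_edges E F tF.
apply: (bodies_too_dense (bodies E F)) => //; last first.
  move=> bs A ubs sbs sz; apply: (swap_bodies F E) => //.
  exact: leq_trans sz _.
(* The 500 extension sets have at least 0.247 n elements each. The error term 10 per tetrahedron
   costs at most 2.5 n, or 0.005 n per edge, which leaves at least 0.242 n tetrahedra with a hub. *)
have lo : #|E| * (247 * #|T|) <= 1000 * \sum_(e in E) #|ext e|.
  rewrite -sum_nat_const big_distrr; apply: leq_sum => e eE.
  by have [_ _ eG] := in_edges _ _ tF (subsetP EF _ eE); apply: card_ext.
have := sum_card_ext F E mF EF; have := card_tets F tF; rewrite cB.
move: lo; rewrite cE; move: (\sum_(e in E) _) #|tets F| #|hubs E F| #|T|; clear; lia.
Qed.

(** The tetrahedra of a maximal tiling miss at most 5 uncovered vertices and the 3 * 500 that its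
    edges may cover. *)
Lemma tetrahedron_packing_exists :
    (forall x y, x != y -> 749 * #|T| <= 1000 * #|nbr x y|) ->
    37 * 500 < #|T| ->
  exists P, is_tet_packing G P /\ #|~: cover P| <= 1505.
Proof.
move=> deg bigT; have [F mF] := max_tiling_exists; have tF := mF.1.
have E500 : #|edges F| < 500 by apply: few_edges => //; apply: leq_trans bigT.
exists (tets F); split.
  rewrite /is_tet_packing trivIset_tets // andbT.
  by apply/forall_inP=> K /(in_tets _ _ tF)[].
have R5 := uncovered_small F 500 deg mF (ltnW E500) bigT.
have sub : ~: cover (tets F) \subset ~: cover F :|: cover (edges F).
  apply/subsetP=> x; rewrite (cover_split F tF) !inE.
  by case: (x \in cover (tets F)); case: (x \in cover (edges F)).
apply: leq_trans (subset_leq_card sub) _; apply: leq_trans (leq_card_setU _ _) _.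
apply: (@leq_trans (5 + 3 * #|edges F|)); first exact: leq_add (card_cover_edges F).
by rewrite (@leq_add2l 5 _ (3 * 500)) leq_mul2l ltnW.
Qed.

End Tilings.

Local Open Scope ring_scope.

Theorem theorem8p2 (R : realType) :
  exists c0 : R, 0 < c0 /\
  forall c : R, 0 < c -> c < c0 ->
  exists l0 : nat, forall l : nat, (l0 <= l)%N ->
  exists n0 : nat, forall n : nat, (n0 <= n)%N ->
  forall G : {set {set 'I_n}}, is_3graph G ->
    (forall x y : 'I_n, x != y -> (3 / 4 - c) * n%:R <= (codeg G x y)%:R) ->
    exists P : {set {set 'I_n}}, is_tet_packing G P /\ (#|~: cover P| <= l)%N.
Proof.
(* The density used above is 749/1000 = 3/4 - 1/1000. *)
exists (1 / 1000); split; first by lra.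
move=> c c_gt0 c_lt; exists 1505%N => l le_l; exists (37 * 500).+1%N => n le_n G G3 deg.
have [||P [tP cP]] := tetrahedron_packing_exists _ G G3.
- move=> x y xy; rewrite card_ord (card_nbr _ G G3 x y xy) -(ler_nat R) !natrM.
  have := deg x y xy; have : 0 <= (1 / 1000 - c) * n%:R.
    by rewrite mulr_ge0 ?ler0n // subr_ge0 ltW.
  set u := n%:R; set v := (codeg G x y)%:R; set w := c * u.
  by rewrite !mulrBl -/w; lra.
- by rewrite card_ord.
by exists P; split=> //; apply: leq_trans le_l.
Qed.
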